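(* Let $p\in(0,1)$, let $\ell\ge 1$ be fixed, and let $x_e$, $e\in\binom{[n]}{2}$, be independent Bernoulli($p$) random variables, with $\chi_e=(x_e-p)/\sqrt{p(1-p)}$. Suppose \[F(\mathbf{x})=\sum_{H:\,v(H)\le\ell}\binom{n-v(H)}{\ell-v(H)}\Phi_H\,\gamma_H(\mathbf{x}),\] where the sum is over isomorphism classes of graphs $H$ without isolated vertices on at most $\ell$ vertices, the $\Phi_H$ are real constants independent of $n$, and (1) $\Phi_H=0$ for every connected graph $H$ on $3$ or $4$ vertices; (2) $\Phi_{K_2}\neq0$ and $\Phi_{K_2+K_2}\neq 0$, where $K_2+K_2$ is the disjoint union of two edges. Suppose further that $F$ is integer valued. Then there is a sequence $(y_n)$ such that $\mathbb{P}[F(\mathbf{x})=y_n]\gtrsim n^{3/2-\ell}$, the implicit constant depending on $p$ and the constants $\Phi_H$ (and $\ell$).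
   Context: For a graph $H$ with no isolated vertices, the graph factor is $\gamma_H(\mathbf{x})=\sum_{E\subseteq\binom{[n]}{2},\,E\simeq H}\prod_{e\in E}\chi_e$, the sum over edge sets $E$ whose spanned graph is isomorphic to $H$; for the empty graph $\gamma_{K_0}=1$. *)

(* Defs.v *)
From HB Require Import structures.
From mathcomp Require Import all_boot all_order all_fingroup all_algebra.
From mathcomp Require Import reals.
Set Implicit Arguments. Unset Strict Implicit. Unset Printing Implicit Defensive.
Import Order.TTheory GRing.Theory Num.Theory.
Local Open Scope ring_scope.

(* Graphs are edge sets: a graph on a finite vertex type V is a set of
   2-element subsets of V.  Vertex set of a graph without isolated vertices
   = union of its edges. *)
Definition vset (V : finType) (G : {set {set V}}) : {set V} := cover G.

Definition Edges (n : nat) : {set {set 'I_n}} := [set e : {set 'I_n} | #|e| == 2%N].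

Definition is_graph (V : finType) (G : {set {set V}}) : Prop :=
  forall e, e \in G -> #|e| = 2%N.

Definition adj (V : finType) (G : {set {set V}}) : rel V :=
  fun x y => [exists e in G, [&& x \in e, y \in e & x != y]].
Definition connected_graph (V : finType) (G : {set {set V}}) : Prop :=
  forall x y, x \in vset G -> y \in vset G -> connect (adj G) x y.

(* relabel a graph E on [n] with at most l (non-isolated) vertices onto the
   vertex set 'I_l, sending the k-th vertex of V(E) (increasing order) to k.
   Only an injective relabelling matters, since Phi is isomorphism invariant. *)
Definition relabel (l n : nat) (E : {set {set 'I_n}}) : {set {set 'I_l}} :=
  [set [set j : 'I_l | [exists i : 'I_n in e, nat_of_ord j == index i (enum (vset E))]]
     | e : {set 'I_n} in E].

(* sample space: outcomes omega = set of present edges (x_e = [e \in omega]) *)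
Section F.
Variables (R : realType) (p : R) (l : nat) (Phi : {set {set 'I_l}} -> R).

Definition chi (n : nat) (omega : {set {set 'I_n}}) (e : {set 'I_n}) : R :=
  ((e \in omega)%:R - p) / Num.sqrt (p * (1 - p)).

(* F(x) = sum_{E subset binom([n],2), v(E) <= l} C(n-v(E), l-v(E)) Phi_E prod_{e in E} chi_e,
   which equals sum over iso classes H of C(n-v(H),l-v(H)) Phi_H gamma_H(x). *)
Definition Ffun (n : nat) (omega : {set {set 'I_n}}) : R :=
  \sum_(E in powerset (Edges n) | (#|vset E| <= l)%N)
     'C(n - #|vset E|, l - #|vset E|)%:R * Phi (relabel l E) *
     \prod_(e in E) chi omega e.

Definition ProbF (n : nat) (y : R) : R :=
  \sum_(omega in powerset (Edges n) | Ffun omega == y)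
     p ^+ #|omega| * (1 - p) ^+ (#|Edges n| - #|omega|).
End F.

(* Main.v *)
Require Import Defs.
From HB Require Import structures.
From mathcomp Require Import all_boot all_order all_fingroup all_algebra.
From mathcomp Require Import reals zify ring lra.
Set Implicit Arguments. Unset Strict Implicit. Unset Printing Implicit Defensive.
Import Order.TTheory GRing.Theory Num.Theory.
Local Open Scope ring_scope.

(* Among the Fourier-Walsh terms of F, those of degree at most 2 with the
   coefficient of K_2 + K_2 given to every pair of distinct edges (cherries
   included) sum to a function g of the number of edges m of the graph. What
   remains lives on cherries, with coefficient O(n^(l-4)), and on graphs with
   v >= 5 vertices, with coefficient O(n^(l-v)): by condition (1) nothing else
   survives. By orthonormality its second moment is O(n^(2l-5)). By Chebyshev,
   with probability at least 1/2 both m lies in a window of length O(n) and F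
   lies within O(n^(l-5/2)) of g(m). As F is an integer, this leaves
   O(n^(l-3/2)) pairs (m, F), so some value of F has probability at least of
   order n^(3/2-l). *)

(** * Fourier-Walsh analysis on the biased cube *)

Lemma sum_powerset_prod (K : comPzRingType) (T : finType) (D : {set T})
    (u : T -> bool -> K) :
  \sum_(A in powerset D) \prod_(e in D) u e (e \in A) =
  \prod_(e in D) (u e true + u e false).
Proof.
(* Outside [D] the factor is 0 when the element is chosen and 1 otherwise. A sum over all sets then
   only sees subsets of [D], and the product distributes. *)
pose v e b : K := if e \in D then u e b else (~~ b)%:R.
transitivity (\sum_(A in {set T}) \prod_e (if e \in A then v e true else v e false)); last first.
  rewrite -bigA_distr [RHS]big_mkcond /=; apply: eq_bigr => e _.
  by rewrite /v; case: (e \in D); rewrite //= add0r.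
rewrite big_mkcond /=; apply: eq_bigr => A _.
rewrite powersetE; case: (boolP (A \subset D)) => [sAD | /subsetPn[x xA xD]].
  rewrite [LHS]big_mkcond /=; apply: eq_bigr => e _.
  rewrite /v; case: (boolP (e \in D)) => eD; first by case: (e \in A).
  by rewrite (negPf (contraNN (subsetP sAD e) eD)).
by rewrite (bigD1 x) //= xA /v (negPf xD) mul0r.
Qed.

Section BiasedWalsh.
Variables (R : realType) (p : R).
Hypothesis hp : 0 < p < 1.

Definition bchi (b : bool) : R := (b%:R - p) / Num.sqrt (p * (1 - p)).

Variables (T : finType) (D : {set T}).
Implicit Types (A E F : {set T}) (a : {set T} -> R).

Definition walsh (E A : {set T}) : R := \prod_(e in E) bchi (e \in A).
Definition bweight (A : {set T}) : R := p ^+ #|A| * (1 - p) ^+ (#|D| - #|A|).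
Definition bprob (P : pred {set T}) : R := \sum_(A in powerset D | P A) bweight A.
Definition wsum (a : {set T} -> R) (A : {set T}) : R :=
  \sum_(E in powerset D) a E * walsh E A.

Let pq_gt0 : 0 < p * (1 - p).
Proof. by case/andP: hp => p0 p1; rewrite mulr_gt0 // subr_gt0. Qed.

Let sd_gt0 : 0 < Num.sqrt (p * (1 - p)).
Proof. by rewrite sqrtr_gt0. Qed.

Let sdE : Num.sqrt (p * (1 - p)) ^+ 2 = p * (1 - p).
Proof. by rewrite sqr_sqrtr // ltW. Qed.

Lemma bchi_mean : p * bchi true + (1 - p) * bchi false = 0.
Proof. by rewrite /bchi /=; field; rewrite gt_eqF. Qed.

Lemma bchi_var : p * bchi true ^+ 2 + (1 - p) * bchi false ^+ 2 = 1.
Proof.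
rewrite /bchi /= !exprMn exprVn sdE; field.
by case/andP: hp => p0 p1; rewrite !gt_eqF // subr_gt0.
Qed.

Lemma bweightE A : A \subset D ->
  bweight A = \prod_(e in D) (if e \in A then p else 1 - p).
Proof.
move=> sAD; rewrite (big_setID A) /= (setIidPr sAD).
rewrite (eq_bigr (fun=> p)) => [|e ->//]; rewrite prodr_const.
rewrite (eq_bigr (fun=> 1 - p)) => [|e]; last by rewrite inE => /andP[/negPf->].
by rewrite prodr_const cardsDS.
Qed.

Lemma bweight_ge0 A : 0 <= bweight A.
Proof. by case/andP: hp => /ltW p0 /ltW p1; rewrite mulr_ge0 // exprn_ge0 // subr_ge0. Qed.

Lemma bweight_sum : \sum_(A in powerset D) bweight A = 1.
Proof.
under eq_bigr => A; first (rewrite powersetE => sAD; rewrite bweightE //; over).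
rewrite (sum_powerset_prod D (fun _ b => if b then p else 1 - p)) /=.
by rewrite big1 // => e _; ring.
Qed.

Lemma walsh_prod E A : E \subset D ->
  walsh E A = \prod_(e in D) (if e \in E then bchi (e \in A) else 1).
Proof.
move=> /setIidPr ED; rewrite -big_mkcondr /= /walsh; apply: eq_bigl => e.
by rewrite -{1}ED inE.
Qed.

(** The product measure splits the expectation into one factor per element. An element of both sets
    contributes the variance 1, an element of neither contributes 1, and an element of exactly one
    contributes the mean 0. *)
Lemma walsh_orthonormal E F : E \subset D -> F \subset D ->
  \sum_(A in powerset D) bweight A * (walsh E A * walsh F A) = (E == F)%:R.
Proof.
move=> ED FD.
pose u e b := (if b then p else 1 - p) *
  ((if e \in E then bchi b else 1) * (if e \in F then bchi b else 1)).
transitivity (\sum_(A in powerset D) \prod_(e in D) u e (e \in A)).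
  apply: eq_bigr => A; rewrite powersetE => AD.
  by rewrite bweightE // !walsh_prod // -!big_split.
rewrite sum_powerset_prod; have [EF | EF] := E =P F.
  apply: big1 => e _; rewrite /u EF; case: (e \in F); last by ring.
  by rewrite -!expr2 bchi_var.
have /existsP[x xEF] : [exists x, (x \in E) != (x \in F)].
  apply: contraT; rewrite negb_exists => /forallP H; case: EF.
  by apply/setP => x; apply/eqP; have := H x; rewrite negbK.
have xD : x \in D.
  by move: xEF (subsetP ED x) (subsetP FD x);
    case: (x \in E); case: (x \in F) => // _ H1 H2; [apply: H1 | apply: H2].
rewrite (bigD1 x) //= [X in X * _](_ : _ = 0) ?mul0r //.
by rewrite /u -bchi_mean; move: xEF; case: (x \in E); case: (x \in F) => // _; ring.
Qed.

Lemma parseval a :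
  \sum_(A in powerset D) bweight A * wsum a A ^+ 2 =
  \sum_(E in powerset D) a E ^+ 2.
Proof.
transitivity (\sum_(E in powerset D) \sum_(F in powerset D) \sum_(A in powerset D)
    a E * a F * (bweight A * (walsh E A * walsh F A))).
  under [RHS]eq_bigr do rewrite exchange_big /=.
  rewrite [RHS]exchange_big /=; apply: eq_bigr => A _.
  rewrite expr2 /wsum mulr_suml mulr_sumr; apply: eq_bigr => E _.
  by rewrite !mulr_sumr; apply: eq_bigr => F _; ring.
apply: eq_bigr => E; rewrite powersetE => ED.
transitivity (\sum_(F in powerset D) a E * a F * (E == F)%:R).
  by apply: eq_bigr => F; rewrite powersetE => FD; rewrite -mulr_sumr walsh_orthonormal.
rewrite (bigD1 E) ?powersetE //= eqxx mulr1 big1 ?addr0 // => F /andP[_ FE].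
by rewrite eq_sym (negPf FE) mulr0.
Qed.

(** Markov's inequality for the square, whose expectation is given by Parseval. *)
Lemma wsum_tail a (t V : R) : 0 < t -> \sum_(E in powerset D) a E ^+ 2 <= V ->
  bprob (fun A => t < wsum a A ^+ 2) <= V / t.
Proof.
move=> t0; rewrite -parseval => hV; rewrite ler_pdivlMr //; apply: le_trans hV.
rewrite /bprob mulr_suml big_mkcondr /=; apply: ler_sum => A _.
case: ifP => [h | _]; first by rewrite ler_wpM2l ?bweight_ge0 // ltW.
by rewrite mulr_ge0 ?bweight_ge0 ?sqr_ge0.
Qed.

(** The left side is the k-th elementary symmetric polynomial in the numbers [bchi (e \in A)]. Only
    two distinct numbers occur, with multiplicities [#|A|] and [#|D| - #|A|], so it depends on [A]
    through its size alone (a Krawtchouk polynomial up to scaling). *)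
Lemma walsh_elementary_sum A k : A \subset D ->
  \sum_(E in powerset D | #|E| == k) walsh E A =
  ((1 + bchi true *: 'X) ^+ #|A| * (1 + bchi false *: 'X) ^+ (#|D| - #|A|))`_k.
Proof.
move=> AD.
have -> : (1 + bchi true *: 'X) ^+ #|A| * (1 + bchi false *: 'X) ^+ (#|D| - #|A|)
   = \prod_(e in D) (bchi (e \in A) *: 'X + 1) :> {poly R}.
  rewrite [RHS](big_setID A) /= (setIidPr AD); congr (_ * _).
    by rewrite -prodr_const; apply: eq_bigr => e ->; rewrite addrC.
  rewrite -cardsDS // -prodr_const; apply: eq_bigr => e.
  by rewrite inE => /andP[/negPf-> _]; rewrite addrC.
rewrite -(sum_powerset_prod D (fun e b => if b then bchi (e \in A) *: 'X else 1)).
rewrite coef_sum big_mkcondr /=; apply: eq_bigr => E; rewrite powersetE => ED.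
rewrite -big_mkcondr /= (eq_bigl (mem E)); last first.
  by move=> e /=; rewrite andb_idl // => /(subsetP ED).
rewrite (eq_bigr (fun e => (bchi (e \in A))%:P * 'X)); last first.
  by move=> e _; rewrite mul_polyC.
rewrite big_split /= -rmorph_prod /= prodr_const coefCM coefXn eq_sym.
by case: eqP => _; rewrite ?mulr1 ?mulr0.
Qed.

Lemma wsum_card (b : nat -> R) (d : nat) :
  exists g : nat -> R, forall A, A \subset D ->
    wsum (fun E => if (#|E| < d)%N then b #|E| else 0) A = g #|A|.
Proof.
exists (fun m => \sum_(k < d) b k *
  ((1 + bchi true *: 'X) ^+ m * (1 + bchi false *: 'X) ^+ (#|D| - m))`_k).
move=> A AD; transitivity (\sum_(k < d) \sum_(E in powerset D | #|E| == k) b k * walsh E A).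
  under [RHS]eq_bigr do rewrite big_mkcondr.
  rewrite exchange_big /=; apply: eq_bigr => E _.
  case: ltnP => h; last first.
    by rewrite mul0r big1 // => k _; rewrite gtn_eqF ?(leq_trans _ h).
  rewrite (bigD1 (Ordinal h)) //= eqxx big1 ?addr0 // => k kh.
  by case: eqP => // e; move: kh; rewrite -val_eqE /= -e eqxx.
by apply: eq_bigr => k _; rewrite -mulr_sumr walsh_elementary_sum.
Qed.

(** Presents the centred size of [A] as a Walsh sum, so that [wsum_tail] gives its concentration. *)
Lemma wsum_degree1 A : A \subset D ->
  wsum (fun E => (#|E| == 1%N)%:R) A =
  (#|A|%:R - p * #|D|%:R) / Num.sqrt (p * (1 - p)).
Proof.
move=> AD; rewrite /wsum.
transitivity (\sum_(e in D) bchi (e \in A)).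
  rewrite (eq_bigr (fun E : {set T} => if #|E| == 1%N then walsh E A else 0)); last first.
    by move=> E _; case: eqP => _; rewrite ?mul1r ?mul0r.
  rewrite -big_mkcondr /=.
  rewrite (eq_bigl (mem [set [set e] | e in D])); last first.
    move=> E /=; rewrite powersetE; apply/andP/imsetP.
      by case=> ED /cards1P[e Ee]; exists e => //; rewrite -sub1set -Ee.
    by case=> e eD ->; rewrite sub1set eD cards1.
  rewrite big_imset /=; last by move=> x y _ _; apply: set1_inj.
  by apply: eq_bigr => e _; rewrite /walsh big_set1.
rewrite /bchi -mulr_suml sumrB; congr ((_ - _) / _); last first.
  by rewrite sumr_const mulr_natr.
rewrite -(natr_sum R) -big_mkcondr; congr _%:R.
rewrite sum1dep_card; apply: eq_card => e; rewrite !inE andb_idl //.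
exact: subsetP.
Qed.

Lemma card_tail : 0 < #|D|%:R :> R ->
  bprob (fun A => #|D|%:R < (#|A|%:R - p * #|D|%:R) ^+ 2) <= 4^-1.
Proof.
move=> N0.
have h1 : \sum_(E in powerset D) (#|E| == 1%N)%:R ^+ 2 <= #|D|%:R :> R.
  rewrite (eq_bigr (fun E : {set T} => if #|E| == 1%N then 1%:R else 0)); last first.
    by move=> E _; case: eqP => _; rewrite ?expr1n ?expr0n.
  rewrite -big_mkcondr /= -natr_sum ler_nat sum1dep_card.
  rewrite -(bin1 #|D|) -cards_draws; apply: eq_leq; apply: eq_card => E.
  by rewrite !inE.
(* Normalizing divides the squared deviation by [p * (1 - p)], which is at most 1/4; this is the
   source of the factor 4. The normalized sum has second moment at most [#|D|], so the tail is at
   most 1/4. *)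
apply: le_trans (_ : bprob (fun A => 4 * #|D|%:R <
    wsum (fun E => (#|E| == 1%N)%:R) A ^+ 2) <= _); last first.
  apply: le_trans (wsum_tail _ h1) _; first by rewrite mulr_gt0.
  by rewrite invfM mulrCA divff ?mulr1 // gt_eqF.
rewrite /bprob big_mkcondr [leRHS]big_mkcondr /=; apply: ler_sum => A; rewrite powersetE => AD.
rewrite wsum_degree1 // expr_div_n sdE.
case: ifP => [h|]; last by case: ifP => // *; apply: bweight_ge0.
rewrite ifT // ltr_pdivlMr //.
have h2 : p * (1 - p) <= 4^-1.
  by have := sqr_ge0 (p - 2^-1); rewrite expr2; lra.
apply: le_lt_trans h; rewrite -[leRHS]mulr1 -mulrA.
rewrite -subr_ge0; set N := #|D|%:R in N0 *; nra.
Qed.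

End BiasedWalsh.

(** * Small graphs and their images under injections *)

Section GraphCombinatorics.
Variables (V W : finType).
Implicit Types (E G : {set {set V}}).

Lemma edge_sub_vset E e : e \in E -> e \subset vset E.
Proof. exact: bigcup_sup. Qed.

Lemma card_vset_le E : is_graph E -> (#|vset E| <= 2 * #|E|)%N.
Proof.
move=> gE; apply: leq_trans (leq_card_cover E).1 _.
by rewrite (eq_bigr (fun=> 2%N)) ?sum_nat_const 1?mulnC // => e /gE.
Qed.

Lemma card_vset_ge3 E : is_graph E -> (1 < #|E|)%N -> (2 < #|vset E|)%N.
Proof.
move=> gE /card_gt1P[e [f [eE fE ef]]].
have efs : e :|: f \subset vset E by rewrite subUset !edge_sub_vset.
apply: (@leq_trans #|e :|: f|); last exact: subset_leq_card efs.
rewrite ltnNge; apply: contra ef => h.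
have he : e = e :|: f by apply/eqP; rewrite eqEcard subsetUl (gE e eE).
have hf : f = e :|: f by apply/eqP; rewrite eqEcard subsetUr (gE f fE).
by rewrite he {2}hf.
Qed.

Lemma two_edges_on_four_vertices E : is_graph E -> #|vset E| = 4%N -> #|E| = 2%N ->
  exists e f, [/\ E = [set e; f], #|e| = 2%N, #|f| = 2%N & [disjoint e & f]].
Proof.
move=> gE v4 /eqP/cards2P[e [f [ef Eef]]]; exists e, f.
have [e2 f2] : #|e| = 2%N /\ #|f| = 2%N by rewrite !gE // Eef !inE eqxx ?orbT.
split => //; move: v4; rewrite /vset /cover Eef bigcup_setU !big_set1.
by rewrite cardsU e2 f2 -setI_eq0 -cards_eq0; case: #|_| => [|[|[|[|[]]]]].
Qed.

(** Every component has at least two vertices, so two distinct components already use four. This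
    excludes three vertices; with four vertices both components are pairs, each edge equals one of
    them, and at most two edges exist. *)
Lemma connected_small E : is_graph E ->
  (#|vset E| == 3%N) || (#|vset E| == 4%N) && (2 < #|E|)%N -> connected_graph E.
Proof.
move=> gE hE x y xE yE; apply: contraT => nxy.
have conn_edge e u v : e \in E -> u \in e -> v \in e -> connect (adj E) u v.
  move=> eE ue ve; have [->//|uv] := eqVneq u v.
  by apply: connect1; apply/existsP; exists e; rewrite eE ue ve.
have csym : connect_sym (adj E).
  by apply: sym_connect_sym => u v; apply: eq_existsb => e; rewrite [X in _ && X]andbCA (eq_sym u v).
pose C u := [set z in vset E | connect (adj E) u z].
have eC u e : e \in E -> u \in e -> e \subset C u.
  move=> eE ue; apply/subsetP => z ze.
  by rewrite inE (conn_edge e) // andbT (subsetP (edge_sub_vset eE)).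
have C2 u : u \in vset E -> (1 < #|C u|)%N.
  by case/bigcupP => e eE ue; rewrite -(gE e eE) subset_leq_card // eC.
have dC : [disjoint C x & C y].
  rewrite -setI_eq0; apply/eqP/setP => z; rewrite !inE.
  apply/negP => /andP[/andP[_ xz] /andP[_ yz]]; case/negP: nxy.
  by apply: connect_trans xz _; rewrite csym.
have sC : C x :|: C y \subset vset E.
  by apply/subsetP => z; rewrite !inE => /orP[] /andP[].
have cC : #|C x :|: C y| = (#|C x| + #|C y|)%N.
  by rewrite cardsU (_ : _ :&: _ = set0) ?cards0 ?subn0 //; apply/eqP; rewrite setI_eq0.
have := subset_leq_card sC; rewrite cC => le.
have := C2 _ xE; have := C2 _ yE => y2 x2.
have h22 : (4 <= #|C x| + #|C y|)%N by rewrite (leq_add x2 y2).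
have v4 : #|vset E| = 4%N.
  by case/orP: hE => [/eqP h|/andP[/eqP]//]; move: (leq_trans h22 le); rewrite h.
have E2 : (2 < #|E|)%N by case/orP: hE => [|/andP[]//]; rewrite v4.
rewrite v4 in le.
have cx : #|C x| = 2%N.
  apply/eqP; rewrite eqn_leq x2 andbT.
  by rewrite -(leq_add2r 2); apply: leq_trans le; rewrite leq_add2l.
have cy : #|C y| = 2%N.
  apply/eqP; rewrite eqn_leq y2 andbT.
  by rewrite -(leq_add2l 2); apply: leq_trans le; rewrite leq_add2r.
have vE : vset E = C x :|: C y by apply/eqP; rewrite eq_sym eqEcard sC cC cx cy v4.
have : E \subset [set C x; C y].
  apply/subsetP => e eE; rewrite !inE.
  have /card_gt0P[u ue] : (0 < #|e|)%N by rewrite gE.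
  have uE := subsetP (edge_sub_vset eE) _ ue.
  have e_eq w : w \in [set x; y] -> u \in C w -> e = C w.
    move=> wxy uw; apply/eqP; rewrite eqEcard (gE e eE) andbC.
    rewrite (_ : #|C w| = 2%N) /=; last by case/set2P: wxy => ->.
    apply/subsetP => z /(subsetP (eC _ _ eE ue)); rewrite !inE => /andP[-> uz].
    by apply: connect_trans uz; move: uw; rewrite inE => /andP[].
  move: (uE); rewrite vE => /setUP[] uC.
    by rewrite (e_eq x) ?eqxx // !inE eqxx.
  by rewrite (e_eq y) ?eqxx ?orbT // !inE eqxx orbT.
move/subset_leq_card; rewrite cards2 => /(leq_trans E2).
by case: (_ != _).
Qed.

Section Transport.
Variables (h : V -> W) (E : {set {set V}}).
Hypothesis hinj : {in vset E &, injective h}.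
Let hE := [set h @: e | e : {set V} in E].

Let edge_inj e : e \in E -> {in e &, injective h}.
Proof. by move=> /edge_sub_vset /subsetP s; apply: sub_in2 hinj. Qed.

Lemma vset_transport : vset hE = h @: vset E.
Proof.
apply/setP => w; apply/bigcupP/imsetP.
  case=> _ /imsetP[e eE ->] /imsetP[v ve ->]; exists v => //.
  exact: subsetP (edge_sub_vset eE) _ ve.
by case=> v /bigcupP[e eE ve] ->; exists (h @: e); rewrite imset_f.
Qed.

Lemma card_vset_transport : #|vset hE| = #|vset E|.
Proof. by rewrite vset_transport card_in_imset. Qed.

Lemma is_graph_transport : is_graph E -> is_graph hE.
Proof. by move=> gE _ /imsetP[e eE ->]; rewrite card_in_imset ?gE //; apply: edge_inj. Qed.

Lemma card_transport : #|hE| = #|E|.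
Proof.
have sub e f : e \in E -> f \in E -> h @: e = h @: f -> e \subset f.
  move=> eE fE ef; apply/subsetP => v ve.
  have : h v \in h @: f by rewrite -ef imset_f.
  case/imsetP => w wf /hinj -> //; first exact: subsetP (edge_sub_vset eE) _ ve.
  exact: subsetP (edge_sub_vset fE) _ wf.
rewrite card_in_imset // => e f eE fE ef; apply/eqP.
by rewrite eqEsubset !sub.
Qed.

End Transport.
End GraphCombinatorics.

(** * Relabelling, and extension of partial bijections to permutations *)

Lemma relabel_transport (l n : nat) (E : {set {set 'I_n}}) :
  (0 < l)%N -> (#|vset E| <= l)%N ->
  exists2 h : 'I_n -> 'I_l, {in vset E &, injective h} &
    relabel l E = [set h @: e | e : {set 'I_n} in E].
Proof.
(* The default [Ordinal l0] never arises on [vset E], where the index is below [#|vset E| <= l];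
   values elsewhere do not matter. *)
move=> l0 vl; pose h (i : 'I_n) := insubd (Ordinal l0) (index i (enum (vset E))).
have hv i : i \in vset E -> h i = index i (enum (vset E)) :> nat.
  by move=> iE; rewrite val_insubd ifT // (leq_trans _ vl) // cardE index_mem mem_enum.
exists h => [i j iE jE hij|].
  have : index i (enum (vset E)) = index j (enum (vset E)) by rewrite -!hv ?hij.
  by apply: (index_inj i); rewrite mem_enum.
apply: eq_in_imset => e eE; apply/setP => j; rewrite inE.
have eV := subsetP (edge_sub_vset eE).
apply/existsP/imsetP => [[i /andP[ie /eqP ji]] | [i ie ->]]; exists i => //.
  by apply: val_inj; rewrite /= hv // eV.
by rewrite ie hv ?eV /=.
Qed.

(** Invariance of [Phi] is stated for permutations of the whole vertex type, so a bijection between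
    two short lists of vertices has to be extended to all of it. *)
Lemma perm_of_uniq (T : finType) (s t : seq T) :
  uniq s -> uniq t -> size s = size t -> exists p : {perm T}, map p s = t.
Proof.
elim: s t => [|x s IH] [|y t] //= => [_ _ _|/andP[xs us] /andP[yt ut] [st]].
  by exists 1%g.
(* The transposition corrects the image of [x] to [y]. It fixes all of [t], since neither [p x] nor
   [y] lies there. *)
have [p pst] := IH t us ut st; exists (p * tperm (p x) y)%g.
rewrite permM tpermL; congr (_ :: _); rewrite -[RHS]pst.
apply/eq_in_map => z zs; rewrite permM tpermD //.
  by apply: contraNneq xs => /perm_inj ->.
by apply: contraNneq yt => ->; rewrite -pst map_f.
Qed.

Lemma perm_edge (T : finType) (e f : {set T}) : #|e| = 2%N -> #|f| = 2%N ->
  exists s : {perm T}, s @: e = f.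
Proof.
move=> /eqP/cards2P[a [b [ab ->]]] /eqP/cards2P[c [d [cd ->]]].
have [||//|s [sa sb]] := @perm_of_uniq T [:: a; b] [:: c; d].
- by rewrite /= inE ab.
- by rewrite /= inE cd.
by exists s; rewrite imsetU !imset_set1 sa sb.
Qed.

Lemma perm_matching (T : finType) (e1 e2 f1 f2 : {set T}) :
  #|e1| = 2%N -> #|e2| = 2%N -> #|f1| = 2%N -> #|f2| = 2%N ->
  [disjoint e1 & e2] -> [disjoint f1 & f2] ->
  exists s : {perm T}, s @: e1 = f1 /\ s @: e2 = f2.
Proof.
move=> /eqP/cards2P[a [b [ab ->]]] /eqP/cards2P[c [d [cd ->]]].
move=> /eqP/cards2P[a' [b' [ab' ->]]] /eqP/cards2P[c' [d' [cd' ->]]] D D'.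
have U (x y z w : T) : x != y -> z != w -> [disjoint [set x; y] & [set z; w]] ->
    uniq [:: x; y; z; w].
  move=> xy zw /pred0P H; have := H x; have := H y.
  rewrite /= !inE !eqxx ?orbT /= => /negbT/norP[yz yw] /negbT/norP[xz xw].
  by rewrite !negb_or xy xz xw yz yw zw.
have [||//|s [sa sb sc sd]] := @perm_of_uniq T [:: a; b; c; d] [:: a'; b'; c'; d'].
- exact: U.
- exact: U.
by exists s; rewrite !imsetU !imset_set1 sa sb sc sd.
Qed.

Lemma card_disjoint_edges (T : finType) (e f : {set T}) :
  #|e| = 2%N -> #|f| = 2%N -> [disjoint e & f] -> #|e :|: f| = 4%N.
Proof.
move=> e_2 f_2 ef; rewrite cardsU e_2 f_2 (_ : _ :&: _ = set0) ?cards0 //.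
by apply/eqP; rewrite setI_eq0.
Qed.

(** * Counting graphs by their number of vertices *)

Lemma leq_bin_exp m k : ('C(m, k) <= m ^ k)%N.
Proof.
apply: leq_trans (_ : m ^_ k <= _)%N; first by rewrite -bin_ffact leq_pmulr ?fact_gt0.
elim: k => [|k IH]; first by rewrite ffactn0 expn0.
by rewrite ffactnSr expnSr leq_mul // leq_subr.
Qed.

(** There are at most [n ^ v] choices of the vertex set [S], and the graph is then a subset of
    [powerset S]. The second factor is crude but free of [n]. *)
Lemma card_vset_eq (n v : nat) :
  (#|[set E in powerset (Edges n) | #|vset E| == v]| <= n ^ v * 2 ^ 2 ^ v)%N.
Proof.
rewrite -sum1_card (partition_big (@vset _) (fun S => #|S| == v)) /=; last first.
  by move=> E; rewrite inE => /andP[].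
apply: leq_trans (_ : \sum_(S : {set 'I_n} | #|S| == v) 2 ^ 2 ^ v <= _)%N.
  apply: leq_sum => S /eqP Sv; rewrite sum1dep_card.
  rewrite -Sv -card_powerset -(card_powerset (powerset S)); apply: subset_leq_card.
  apply/subsetP => E; rewrite inE => /andP[_ /eqP ES].
  by rewrite powersetE; apply/subsetP => e eE; rewrite powersetE -ES edge_sub_vset.
rewrite sum_nat_const leq_mul2r; apply/orP; right.
rewrite -[X in (_ <= X ^ _)%N]card_ord; apply: (leq_trans _ (leq_bin_exp _ _)).
rewrite -card_draws; apply: eq_leq; apply: eq_card => S; rewrite inE //.
Qed.

(** * Coefficients and second moment of the residual *)

Section Residual.
Variables (R : realType) (p : R) (l : nat) (Phi : {set {set 'I_l}} -> R).
Hypothesis Phi_inv : forall (s : {perm 'I_l}) (G : {set {set 'I_l}}),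
  Phi [set s @: e | e : {set 'I_l} in G] = Phi G.
Hypothesis Phi_conn : forall G : {set {set 'I_l}}, is_graph G ->
  connected_graph G -> (#|vset G| == 3%N) || (#|vset G| == 4%N) -> Phi G = 0.
Variables e0 e1 e2 : {set 'I_l}.
Hypotheses (e0_2 : #|e0| = 2%N) (e1_2 : #|e1| = 2%N) (e2_2 : #|e2| = 2%N).
Hypothesis e12 : [disjoint e1 & e2].

Let l4 : (4 <= l)%N.
Proof.
have := subset_leq_card (subsetT (e1 :|: e2)).
by rewrite cardsT card_ord card_disjoint_edges.
Qed.

Let l_gt0 : (0 < l)%N.
Proof. exact: leq_trans l4. Qed.

Variable n : nat.
Implicit Types (E : {set {set 'I_n}}) (e f : {set 'I_n}).

Definition Fcoef E : R :=
  if (#|vset E| <= l)%N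
  then 'C(n - #|vset E|, l - #|vset E|)%:R * Phi (relabel l E) else 0.

Lemma FfunE (omega : {set {set 'I_n}}) :
  Ffun p Phi omega = wsum p (Edges n) Fcoef omega.
Proof.
rewrite /Ffun /wsum big_mkcondr /=; apply: eq_bigr => E _.
by rewrite /Fcoef; case: ifP => // _; rewrite mul0r.
Qed.

(** The coefficients in [F] of the empty graph, of K_2 and of K_2 + K_2, indexed by the number of
    edges so that [wsum_card] applies. Values at [k > 2] are cut off where it is used. *)
Definition Fclass (k : nat) : R :=
  match k with
  | 0 => 'C(n, l)%:R * Phi set0
  | 1 => 'C(n - 2, l - 2)%:R * Phi [set e0]
  | _ => 'C(n - 4, l - 4)%:R * Phi [set e1; e2]
  end.

(* Keeps the cherries, with coefficient [- Fclass 2], and the graphs on at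
   least 5 vertices. *)
Definition Fres E : R := Fcoef E - (if (#|E| < 3)%N then Fclass #|E| else 0).

Lemma Phi_relabel_connected E : is_graph E -> (#|vset E| <= l)%N ->
  (#|vset E| == 3%N) || (#|vset E| == 4%N) && (2 < #|E|)%N ->
  Phi (relabel l E) = 0.
Proof.
move=> gE vl vE; have [h hinj ->] := relabel_transport l_gt0 vl.
have gh := is_graph_transport hinj gE.
apply: Phi_conn => //.
  by apply: connected_small => //; rewrite card_vset_transport // card_transport.
by rewrite card_vset_transport //; case/orP: vE => [->//|/andP[->]]; rewrite orbT.
Qed.

Lemma Fcoef_connected E : is_graph E ->
  (#|vset E| == 3%N) || (#|vset E| == 4%N) && (2 < #|E|)%N -> Fcoef E = 0.
Proof.
move=> gE vE; rewrite /Fcoef; case: ifP => // vl.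
by rewrite Phi_relabel_connected // mulr0.
Qed.

Lemma Fcoef_empty : Fcoef set0 = Fclass 0.
Proof.
by rewrite /Fcoef /vset /cover big_set0 cards0 leq0n !subn0 /relabel imset0.
Qed.

Lemma Fcoef_edge e : #|e| = 2%N -> Fcoef [set e] = Fclass 1.
Proof.
move=> e_2; have ve : vset [set e] = e by rewrite /vset /cover big_set1.
have vl : (#|vset [set e]| <= l)%N by rewrite ve e_2 (leq_trans _ l4).
rewrite /Fcoef vl ve e_2; congr (_ * _).
have [h hinj ->] := relabel_transport l_gt0 vl.
rewrite imset_set1; rewrite ve in hinj.
have [s se] := perm_edge e0_2 (etrans (card_in_imset hinj) e_2).
by rewrite -se -(Phi_inv s [set e0]) imset_set1.
Qed.

Lemma Fcoef_matching e f : #|e| = 2%N -> #|f| = 2%N -> [disjoint e & f] ->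
  Fcoef [set e; f] = Fclass 2.
Proof.
move=> e_2 f_2 ef.
have ve : vset [set e; f] = e :|: f by rewrite /vset /cover bigcup_setU !big_set1.
have v4 : #|vset [set e; f]| = 4%N by rewrite ve card_disjoint_edges.
have vl : (#|vset [set e; f]| <= l)%N by rewrite v4.
rewrite /Fcoef vl v4; congr (_ * _).
have [h hinj ->] := relabel_transport l_gt0 vl.
rewrite imsetU !imset_set1; rewrite ve in hinj.
have he : #|h @: e| = 2%N.
  by rewrite card_in_imset //; apply: sub_in2 hinj => x xe; rewrite inE xe.
have hf : #|h @: f| = 2%N.
  by rewrite card_in_imset //; apply: sub_in2 hinj => x xf; rewrite inE xf orbT.
have dh : [disjoint h @: e & h @: f].
  apply/pred0P => w /=; apply/negP => /andP[/imsetP[x xe ->] /imsetP[y yf hxy]].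
  have exy : x = y by apply: hinj hxy; rewrite inE ?xe ?yf ?orbT.
  by have /pred0P/(_ x) := ef; rewrite /= xe exy yf.
have [s [s1 s2]] := perm_matching e1_2 e2_2 he hf e12 dh.
by rewrite -s1 -s2 -(Phi_inv s [set e1; e2]) imsetU !imset_set1.
Qed.

(** With at most two edges, only the cherry has a coefficient other than [Fclass #|E|]: it is
    connected on three vertices, so its own coefficient is 0. With three or more edges nothing is
    subtracted, and three or four vertices force connectedness, hence coefficient 0. *)
Lemma Fres_cases E : is_graph E ->
  [\/ Fres E = 0,
      #|vset E| = 3%N /\ `|Fres E| <= `|Fclass 2|
    | (4 < #|vset E| <= l)%N /\
      Fres E = 'C(n - #|vset E|, l - #|vset E|)%:R * Phi (relabel l E)].
Proof.
move=> gE; rewrite /Fres.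
have [E3|E3] := ltnP.
  case cE: #|E| E3 => [|[|[|//]]] _.
  - by move/cards0_eq: cE => ->; rewrite Fcoef_empty subrr; constructor 1.
  - have /cards1P[e Ee] : #|E| == 1%N by rewrite cE.
    by rewrite Ee Fcoef_edge ?subrr; [constructor 1 | apply: gE; rewrite Ee inE].
  - have v3 : (2 < #|vset E|)%N by rewrite card_vset_ge3 ?cE.
    have := card_vset_le gE; rewrite cE leq_eqVlt => /orP[/eqP v4|].
      have [e [f [-> e_2 f_2 ef]]] := two_edges_on_four_vertices gE v4 cE.
      by rewrite Fcoef_matching // subrr; constructor 1.
    rewrite ltnS => v3'; have v3E : #|vset E| = 3%N by apply/eqP; rewrite eqn_leq v3 v3'.
    by rewrite Fcoef_connected ?v3E // sub0r normrN; constructor 2.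
rewrite subr0; have v3 : (2 < #|vset E|)%N by rewrite card_vset_ge3 // ltnW.
have [v4|v4] := leqP #|vset E| 4.
  rewrite Fcoef_connected //; first by constructor 1.
  by case: #|vset E| v3 v4 => [|[|[|[|[|]]]]] //= _ _; rewrite E3.
rewrite /Fcoef; case: leqP => vl; [by constructor 3 | by constructor 1].
Qed.

Definition Phi_norm : R := \sum_(G : {set {set 'I_l}}) `|Phi G|.

Lemma Phi_le_norm G : `|Phi G| <= Phi_norm.
Proof. by rewrite /Phi_norm (bigD1 G) //= lerDl sumr_ge0. Qed.

Lemma Phi_bin_le G v : `|'C(n - v, l - v)%:R * Phi G| <= n%:R ^+ (l - v) * Phi_norm.
Proof.
rewrite normrM normr_nat ler_pM // ?Phi_le_norm // -natrX ler_nat.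
by apply: leq_trans (leq_bin_exp _ _) _; case: (l - v)%N => // k; rewrite leq_exp2r // leq_subr.
Qed.

Lemma Fres_large E : is_graph E -> (l < #|vset E|)%N -> Fres E = 0.
Proof.
move=> gE vl; case: (Fres_cases gE) => // -[].
  by move=> v3; move: vl; rewrite v3 ltnNge (leq_trans _ l4).
by rewrite [(_ <= l)%N]leqNgt vl andbF.
Qed.

(** The factor [n ^ v] anticipates the number of graphs on [v] vertices. Cherries give the exponent
    3 + 2(l - 4) = 2l - 5, and [v >= 5] gives v + 2(l - v) = 2l - v, at most 2l - 5. *)
Lemma Fres_le E : (0 < n)%N -> is_graph E ->
  Fres E ^+ 2 * n%:R ^+ #|vset E| <= Phi_norm ^+ 2 * n%:R ^+ (2 * l - 5).
Proof.
move=> n0 gE.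
have B0 : 0 <= Phi_norm by apply: sumr_ge0.
have n1 : 1 <= n%:R :> R by rewrite ler1n.
have key (v k : nat) : (v + 2 * k <= 2 * l - 5)%N ->
    #|vset E| = v -> `|Fres E| <= n%:R ^+ k * Phi_norm ->
    Fres E ^+ 2 * n%:R ^+ #|vset E| <= Phi_norm ^+ 2 * n%:R ^+ (2 * l - 5).
  move=> vk -> h; rewrite -real_normK ?num_real //.
  apply: le_trans (_ : (n%:R ^+ k * Phi_norm) ^+ 2 * n%:R ^+ v <= _).
    by rewrite ler_wpM2r ?exprn_ge0 // lerXn2r ?nnegrE // mulr_ge0 ?exprn_ge0.
  rewrite exprMn -exprM mulrAC -exprD mulrC ler_wpM2l ?sqr_ge0 //.
  by rewrite ler_weXn2l // addnC mulnC.
case: (Fres_cases gE) => [->|[v3 h]|[/andP[v5 vl] h]].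
- by rewrite expr0n mul0r mulr_ge0 ?exprn_ge0.
- apply: (key 3%N (l - 4)%N) => //; last exact: le_trans h (Phi_bin_le _ _).
  by move: l4; lia.
- by apply: (key #|vset E| (l - #|vset E|)%N) => //; [lia | rewrite h Phi_bin_le].
Qed.

(** Grouping by vertex number leaves [l.+1] classes; in each, the count from [card_vset_eq] cancels
    the power of [n] in [Fres_le]. *)
Lemma Fres_energy : (0 < n)%N ->
  \sum_(E in powerset (Edges n)) Fres E ^+ 2 <=
  (l.+1 * 2 ^ 2 ^ l)%:R * Phi_norm ^+ 2 * n%:R ^+ (2 * l - 5).
Proof.
move=> n0; set M := Phi_norm ^+ 2 * n%:R ^+ (2 * l - 5).
have M0 : 0 <= M by rewrite mulr_ge0 ?exprn_ge0 ?sumr_ge0.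
have n0R : 0 < n%:R :> R by rewrite ltr0n.
have gr E : E \in powerset (Edges n) -> is_graph E.
  by rewrite powersetE => /subsetP sE e /sE; rewrite inE => /eqP.
have -> : (l.+1 * 2 ^ 2 ^ l)%:R * Phi_norm ^+ 2 * n%:R ^+ (2 * l - 5) =
    \sum_(v < l.+1) (2 ^ 2 ^ l)%:R * M.
  by rewrite sumr_const card_ord -[RHS]mulr_natl natrM /M !mulrA.
apply: le_trans (_ : \sum_(v < l.+1)
    \sum_(E in powerset (Edges n) | #|vset E| == v) Fres E ^+ 2 <= _).
  under [leRHS]eq_bigr do rewrite big_mkcondr.
  rewrite exchange_big /=; apply: ler_sum => E /gr gE.
  have [vl|vl] := leqP #|vset E| l; last first.
    by rewrite Fres_large // expr0n sumr_ge0 // => v _; case: ifP.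
  rewrite (bigD1 (Ordinal (vl : (_ < l.+1)%N))) //= eqxx lerDl sumr_ge0 // => v _.
  by case: ifP => // _; apply: sqr_ge0.
apply: ler_sum => v _.
apply: le_trans (_ : \sum_(E in powerset (Edges n) | #|vset E| == v) M / n%:R ^+ v <= _).
  apply: ler_sum => E /andP[/gr gE /eqP vE].
  by rewrite ler_pdivlMr ?exprn_gt0 // -vE Fres_le.
rewrite sumr_const -[leLHS]mulr_natl mulrCA [leRHS]mulrC ler_wpM2l //.
rewrite ler_pdivrMr ?exprn_gt0 // mulrC -natrX -natrM ler_nat.
apply: leq_trans (_ : n ^ v * 2 ^ 2 ^ v <= _)%N; last first.
  by rewrite leq_mul2l !leq_exp2l // -ltnS ltn_ord orbT.
apply: (leq_trans _ (card_vset_eq n v)); apply: eq_leq; apply: eq_card => E.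
by rewrite inE.
Qed.

End Residual.

(** * Integer windows and the pigeonhole bound *)

Lemma int_window (R : realType) (x B : R) (z : int) : `|z%:~R - x| <= B ->
  exists k : 'I_(Num.truncn (2 * B)).+1, z = Num.ceil (x - B) + k%:Z.
Proof.
rewrite ler_norml => /andP[h1 h2].
have cz : (Num.ceil (x - B) <= z)%R by rewrite ceil_le_int; lra.
have hk : (absz (z - Num.ceil (x - B)) < (Num.truncn (2 * B)).+1)%N.
  rewrite ltnS truncn_ge_nat; last by lra.
  rewrite natr_absz ger0_norm ?subr_ge0 // rmorphB /=.
  by have := ceil_ge (x - B); lra.
by exists (Ordinal hk); rewrite /= gez0_abs ?subr_ge0 //; ring.
Qed.

(** A union bound over the pairs of integers ([#|A|], [F A]): the first lies in a fixed window, the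
    second in a window determined by the first, and each pair has probability at most [delta]. *)
Lemma window_mass (R : realType) (p : R) (hp : 0 < p < 1) (T : finType)
    (D : {set T}) (F : {set T} -> R) (g : nat -> R) (x X B delta : R) :
  (forall A : {set T}, A \subset D -> exists z : int, F A = z%:~R) ->
  (forall y, bprob p D (fun A => F A == y) <= delta) ->
  bprob p D (fun A => (`|#|A|%:R - x| <= X) && (`|F A - g #|A| | <= B)) <=
  (Num.truncn (2 * X)).+1%:R * (Num.truncn (2 * B)).+1%:R * delta.
Proof.
move=> Fint Fdelta.
(* Negative candidates for the size only add spurious terms to the upper bound; at an actual size
   [absz] changes nothing. *)
pose m (j : nat) := absz (Num.ceil (x - X) + j%:Z).
pose y (j k : nat) : R := (Num.ceil (g (m j) - B) + k%:Z)%:~R.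
apply: le_trans (_ : \sum_(j < (Num.truncn (2 * X)).+1)
   \sum_(k < (Num.truncn (2 * B)).+1) bprob p D (fun A => F A == y j k) <= _); last first.
  apply: le_trans (_ : \sum_(j < (Num.truncn (2 * X)).+1)
      \sum_(k < (Num.truncn (2 * B)).+1) delta <= _).
    by apply: ler_sum => j _; apply: ler_sum => k _.
  by rewrite !sumr_const !card_ord -mulrnA -[leLHS]mulr_natl mulnC natrM.
rewrite /bprob [leLHS]big_mkcondr /=.
under [leRHS]eq_bigr do (under eq_bigr do rewrite big_mkcondr; rewrite exchange_big).
rewrite exchange_big /=; apply: ler_sum => A; rewrite powersetE => AD.
have t0 (b : bool) : 0 <= (if b then bweight p D A else 0).
  by case: b => //; apply: bweight_ge0.
case: ifP => [/andP[hA hF]|_]; last first.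
  by apply: sumr_ge0 => j _; apply: sumr_ge0 => k _.
have [j jA] := @int_window R x X #|A|%:Z hA.
have [z zF] := Fint A AD.
have mA : m j = #|A| by rewrite /m -jA.
have [k kF] : exists k : 'I_(Num.truncn (2 * B)).+1, F A = y j k.
  rewrite zF in hF; have [k hk] := int_window hF; exists k.
  by rewrite /y mA -hk.
rewrite (bigD1 j) //= (bigD1 k) //= kF eqxx -addrA lerDl addr_ge0 //.
  by apply: sumr_ge0.
by apply: sumr_ge0 => i _; apply: sumr_ge0.
Qed.

(** * Concentration and pigeonhole combined *)

Theorem theorem6p1 (R : realType) (p : R) (l : nat)
  (Phi : {set {set 'I_l}} -> R) :
  0 < p < 1 -> (1 <= l)%N ->
  (* Phi is a function of the isomorphism class *)
  (forall (s : {perm 'I_l}) (G : {set {set 'I_l}}),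
      Phi [set s @: e | e : {set 'I_l} in G] = Phi G) ->
  (* (1) Phi_H = 0 for connected H on 3 or 4 vertices *)
  (forall G : {set {set 'I_l}}, is_graph G -> connected_graph G ->
      (#|vset G| == 3%N) || (#|vset G| == 4%N) -> Phi G = 0) ->
  (* (2) Phi_{K_2} <> 0 and Phi_{K_2 + K_2} <> 0 *)
  (exists e : {set 'I_l}, #|e| = 2%N /\ Phi [set e] != 0) ->
  (exists e1 e2 : {set 'I_l}, [/\ #|e1| = 2%N, #|e2| = 2%N,
      [disjoint e1 & e2] & Phi [set e1; e2] != 0]) ->
  (* F is integer valued *)
  (forall (n : nat) (omega : {set {set 'I_n}}), omega \subset Edges n ->
      exists z : int, Ffun p Phi omega = z%:~R) ->
  exists y : nat -> R, exists c : R, 0 < c /\ exists N : nat,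
    forall n : nat, (N <= n)%N ->
      c * (n%:R * Num.sqrt n%:R) / n%:R ^+ l <= ProbF p Phi n (y n).
Proof.
move=> hp _ Phi_inv Phi_conn [e0 [e0_2 _]] [e1 [e2 [e1_2 e2_2 e12 _]]] Fint.
have l4 : (4 <= l)%N.
  have := subset_leq_card (subsetT (e1 :|: e2)).
  by rewrite cardsT card_ord card_disjoint_edges.
pose prob n omega := ProbF p Phi n (@Ffun R p l Phi n omega).
(* The most likely value of [F]. Maximizing over the finitely many outcomes suffices, since a value
   never attained has probability 0. *)
pose y n := @Ffun R p l Phi n [arg max_(omega > set0) prob n omega]%O.
pose C : R := (l.+1 * 2 ^ 2 ^ l)%:R * Phi_norm Phi ^+ 2 + 1.
have C0 : 0 < C by rewrite ltr_wpDl // mulr_ge0 ?sqr_ge0.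
pose q := Num.sqrt C.
have q0 : 0 < q by rewrite sqrtr_gt0.
have q1 : 0 < 4 * q + 1 by rewrite addr_gt0 // mulr_gt0.
(* The windows hold at most 2n + 1 <= 3n sizes and 2B + 1 <= (4q + 1)t values, with total mass at
   least 1/2; hence 6 = 2 * 3. *)
exists y, (6 * (4 * q + 1))^-1; split; first by rewrite invr_gt0 mulr_gt0.
(* From two vertices on there is an edge, as [card_tail] requires. *)
exists 2%N => n n2.
have n0 : (0 < n)%N by apply: leq_trans n2.
set delta := ProbF p Phi n (y n).
have delta_max z : bprob p (Edges n) (fun A => Ffun p Phi A == z) <= delta.
  have [/existsP[A /eqP <-]|] := boolP [exists A, @Ffun R p l Phi n A == z].
    rewrite /delta /y; case: arg_maxP => // B _ hB.
    exact: (hB A isT).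
  rewrite negb_exists => /forallP nz.
  rewrite /bprob big_pred0 => [|A]; last by rewrite (negPf (nz A)) andbF.
  by apply: sumr_ge0 => A _; apply: (bweight_ge0 hp).
pose s : R := Num.sqrt n%:R.
have nR1 : 1 <= n%:R :> R by rewrite ler1n.
have nR0 : 0 < n%:R :> R by rewrite ltr0n.
have s0 : 0 < s by rewrite sqrtr_gt0.
have s2 : s ^+ 2 = n%:R by rewrite sqr_sqrtr // ltW.
(* This is n^(l - 5/2), the order of the standard deviation bound for the residual; it is at least 1
   because [l >= 4]. *)
pose t : R := n%:R ^+ l / (n%:R ^+ 2 * s).
have t0 : 0 < t by rewrite divr_gt0 ?mulr_gt0 ?exprn_gt0.
have t1 : 1 <= t.
  rewrite ler_pdivlMr ?mulr_gt0 ?exprn_gt0 // mul1r.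
  apply: le_trans (_ : n%:R ^+ 2 * n%:R ^+ 2 <= _); last by rewrite -exprD ler_weXn2l.
  rewrite ler_wpM2l ?sqr_ge0 // -s2 -exprM ler_eXnr //.
  by rewrite -(ler_pXn2r (_ : 0 < 2)%N) ?nnegrE ?expr1n ?s2 // ltW.
have t2 : t ^+ 2 = n%:R ^+ (2 * l - 5).
  rewrite expr_div_n exprMn s2 -!exprM -exprSr mulnC.
  have -> : (2 * l = (2 * l - 5) + 5)%N by lia.
  by rewrite exprD mulfK ?expf_neq0 ?gt_eqF // addnK.
(* Chosen so that [B ^+ 2] is four times the second moment bound, which makes the Chebyshev tail at
   most 1/4. *)
pose B := 2 * q * t.
have B0 : 0 <= B by apply: ltW; rewrite mulr_gt0 // mulr_gt0.
have B2 : B ^+ 2 = 4 * (C * n%:R ^+ (2 * l - 5)).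
  by rewrite /B exprMn t2 exprMn /q sqr_sqrtr ?(ltW C0) //; ring.
have [g gE] := @wsum_card R p _ (Edges n) (Fclass Phi e0 e1 e2 n) 3.
pose x : R := p * #|Edges n|%:R.
pose good (A : {set {set 'I_n}}) := (`|#|A|%:R - x| <= n%:R) &&
  (`|Ffun p Phi A - g #|A| | <= B).
have upper : bprob p (Edges n) good <=
    (Num.truncn (2 * n%:R : R)).+1%:R * (Num.truncn (2 * B)).+1%:R * delta.
  by apply: window_mass => // A AD; apply: Fint.
have FgE (A : {set {set 'I_n}}) : A \subset Edges n ->
    Ffun p Phi A - g #|A| = wsum p (Edges n) (Fres Phi e0 e1 e2 (n := n)) A.
  move=> AD; rewrite FfunE -gE // /wsum -sumrB; apply: eq_bigr => E _.
  by rewrite -mulrBl.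
have cardE : #|Edges n| = 'C(n, 2).
  rewrite -[in RHS](card_ord n) -card_draws.
  by apply: eq_card => e; rewrite !inE.
have N0 : 0 < #|Edges n|%:R :> R by rewrite ltr0n cardE bin_gt0.
have N2 : #|Edges n|%:R <= n%:R ^+ 2 :> R.
  by rewrite -natrX ler_nat cardE leq_bin_exp.
have V0 : 0 < 4 * (C * n%:R ^+ (2 * l - 5)).
  by rewrite mulr_gt0 // mulr_gt0 ?exprn_gt0.
have bad1 := card_tail hp N0.
have bad2 : bprob p (Edges n) (fun A : {set {set 'I_n}} => 4 * (C * n%:R ^+ (2 * l - 5)) <
    wsum p (Edges n) (Fres Phi e0 e1 e2 (n := n)) A ^+ 2) <= 4^-1.
  apply: le_trans (wsum_tail hp V0 (_ : _ <= C * n%:R ^+ (2 * l - 5))) _.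
    apply: le_trans (Fres_energy Phi_inv Phi_conn e0_2 e1_2 e2_2 e12 n0) _.
    by rewrite ler_wpM2r ?exprn_ge0 // lerDl.
  by rewrite invfM mulrCA divff ?mulr1 // gt_eqF // mulr_gt0 ?exprn_gt0.
have lower : 2^-1 <= bprob p (Edges n) good.
  (* Each outcome is good or lies in one of the two tail events, of probability at most 1/4 each;
     the inequality is checked outcome by outcome. *)
  suff : 1 <= bprob p (Edges n) good +
      (bprob p (Edges n) (fun A : {set {set 'I_n}} => #|Edges n|%:R < (#|A|%:R - p * #|Edges n|%:R) ^+ 2) +
       bprob p (Edges n) (fun A : {set {set 'I_n}} => 4 * (C * n%:R ^+ (2 * l - 5)) <
         wsum p (Edges n) (Fres Phi e0 e1 e2 (n := n)) A ^+ 2)).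
    by move: bad1 bad2; clear; lra.
  rewrite -[leLHS](bweight_sum p (Edges n)) /bprob.
  rewrite [X in X + _]big_mkcondr [X in _ + (X + _)]big_mkcondr.
  rewrite [X in _ + (_ + X)]big_mkcondr -!big_split /=.
  apply: ler_sum => A; rewrite powersetE => AD.
  have w0 : 0 <= bweight p (Edges n) A by apply: bweight_ge0.
  have t_ge0 (b : bool) : 0 <= (if b then bweight p (Edges n) A else 0) by case: b.
  case: ifP => [_|]; first by rewrite lerDl addr_ge0.
  rewrite add0r -FgE // -B2 -/x => /negbT.
  rewrite /good negb_and -!ltNge => /orP[h|h].
    (* A deviation above [n] has square above [n ^ 2], hence above the number of possible edges,
       which is the threshold in [card_tail]. *)
    rewrite ifT; first by rewrite lerDl.
    apply: le_lt_trans N2 _; rewrite -[X in _ < X]real_normK ?num_real //.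
    by rewrite ltrXn2r ?nnegrE // ltW.
  rewrite addrC ifT; first by rewrite lerDl.
  by rewrite -[X in _ < X]real_normK ?num_real // ltrXn2r ?nnegrE.
have delta0 : 0 <= delta by apply: sumr_ge0 => A _; apply: (bweight_ge0 hp).
have S (u : R) : 0 <= u -> (Num.truncn u).+1%:R <= u + 1.
  by move=> u0; rewrite -natr1 lerD2r truncn_le.
have main : 2^-1 <= 3 * n%:R * ((4 * q + 1) * t) * delta.
  apply: le_trans lower (le_trans upper _); rewrite ler_wpM2r //.
  rewrite ler_pM //.
    by apply: le_trans (S _ _) _; [rewrite mulr_ge0 | move: nR1; clear; lra].
  apply: le_trans (S _ _) _; first by rewrite mulr_ge0.
  by rewrite /B; move: t1; clear; lra.
have -> : (6 * (4 * q + 1))^-1 * (n%:R * Num.sqrt n%:R) / n%:R ^+ l =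
    (6 * (4 * q + 1) * (n%:R * t))^-1.
  rewrite -/s /t; field.
  by rewrite !gt_eqF ?exprn_gt0.
rewrite -[X in X <= _]div1r ler_pdivrMr; last first.
  exact: mulr_gt0 (mulr_gt0 (ltr0Sn _ 5) q1) (mulr_gt0 nR0 t0).
by move: main; clear; lra.
Qed.
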